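(* Let $(M,g)$ be a semi-Riemannian manifold of dimension $n\ge3$ that is a $P$-space by Venzi with associated 1-form $\Pi$. (i) If $\Pi$ is non-null at $x\in M$, then $W=0$ at $x$. (ii) If $\Pi$ is null at some $x\in M$, then $M$ is a $W$-space by Venzi with the same associated 1-form $\Pi$.
   Context: $(M,g)$ is a connected smooth semi-Riemannian manifold of dimension $n\ge 3$; $R$ is the $(0,4)$ Riemann curvature tensor, with the sign convention that the Ricci tensor $S(X_2,X_3)$ is the $g$-trace of $R(X_1,X_2,X_3,X_4)$ over $X_1,X_4$; $\kappa$ is the scalar curvature. Projective curvature tensor: $P(X_1,X_2,X_3,X_4)=R(X_1,X_2,X_3,X_4)-\frac{1}{n-1}\left[S(X_2,X_3)g(X_1,X_4)-S(X_1,X_3)g(X_2,X_4)\right]$. Concircular curvature tensor: $W(X_1,X_2,X_3,X_4)=R(X_1,X_2,X_3,X_4)-\frac{\kappa}{n(n-1)}\left[g(X_1,X_4)g(X_2,X_3)-g(X_1,X_3)g(X_2,X_4)\right]$. For a $(0,4)$-tensor $D$, let $\mathcal L(M)$ be the vector space of all 1-forms $\Theta$ on $M$ satisfying $$\Theta(X_1)D(X_2,X_3,X_4,X_5)+\Theta(X_2)D(X_3,X_1,X_4,X_5)+\Theta(X_3)D(X_1,X_2,X_4,X_5)=0$$ for all vector fields $X_1,\dots,X_5$. $M$ is called a $D$-space by Venzi if $\dim\mathcal L(M)\ge1$; a nonzero element of $\mathcal L(M)$ is called an associated 1-form. A 1-form $\Pi$ with $g$-dual vector field $V$ is null at $x$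 if $g_x(V,V)=0$, and non-null at $x$ otherwise. *)

(* Defs.v *)
From HB Require Import structures.
From mathcomp Require Import all_boot all_order all_algebra.
From mathcomp Require Import all_classical all_reals all_analysis.

Set Implicit Arguments.
Unset Strict Implicit.
Unset Printing Implicit Defensive.

Import Order.TTheory GRing.Theory Num.Theory.
Import numFieldNormedType.Exports.

Local Open Scope classical_set_scope.
Local Open Scope ring_scope.

(* MathComp-Analysis has no manifolds.  A smooth manifold is given here by an
   atlas, and a tensor field by its components in each chart of the atlas,
   subject to the classical transformation law.  Points of R^n are row vectors,
   so that ['J f p] has entry (i, j) equal to the i-th partial derivative of the
   j-th coordinate of f, and acts on tangent vectors by [v *m 'J f p]. *)

Section Smoothness.
Variables (R : realType) (n : nat).

Definition partial (i : 'I_n) (f : 'rV[R]_n -> R) : 'rV[R]_n -> R :=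
  fun u => 'D_(delta_mx 0 i) f u.

Definition iter_partial (s : seq 'I_n) (f : 'rV[R]_n -> R) : 'rV[R]_n -> R :=
  foldr partial f s.

(* C^infinity on U.  It is used for open U only: the values of f off U are then
   irrelevant. *)
Definition smooth_on (U : set 'rV[R]_n) (f : 'rV[R]_n -> R) : Prop :=
  forall (s : seq 'I_n) (u : 'rV[R]_n), U u ->
    differentiable (iter_partial s f) u.

End Smoothness.

Section Manifolds.
Variables (R : realType) (n : nat).

(* A homeomorphism [coord], with inverse [param], from the open set [dom] of T
   onto the open set [cod] of R^n; both maps are total, with irrelevant values
   outside these sets. *)
Record chart (T : topologicalType) := Chart {
  dom : set T;
  cod : set 'rV[R]_n;
  coord : T -> 'rV[R]_n;
  param : 'rV[R]_n -> T;
  dom_open : open dom;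
  cod_open : open cod;
  coord_cod : forall x, dom x -> cod (coord x);
  param_dom : forall u, cod u -> dom (param u);
  coordK : forall x, dom x -> param (coord x) = x;
  paramK : forall u, cod u -> coord (param u) = u;
  coord_continuous : forall x, dom x -> {for x, continuous coord};
  param_continuous : forall u, cod u -> {for u, continuous param}
}.

Definition overlap (T : topologicalType) (c d : chart T) : set 'rV[R]_n :=
  [set u | cod c u /\ dom d (param c u)].

Definition transition (T : topologicalType) (c d : chart T) :
  'rV[R]_n -> 'rV[R]_n := coord d \o param c.

(* The atlas is not required to be maximal. *)
Record manifold := Manifold {
  carrier :> topologicalType;
  atlas : set (chart carrier);
  manifold_hausdorff : hausdorff_space carrier;
  manifold_second_countable : @second_countable carrier;
  atlas_cover : forall x : carrier, exists2 c, atlas c & dom c x;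
  atlas_compatible : forall c d, atlas c -> atlas d -> forall j : 'I_n,
    smooth_on (overlap c d) (fun u => transition c d u 0 j)
}.

Definition chart_at (M : manifold) (c : chart M) (x : M) : Prop :=
  atlas c /\ dom c x.

Definition change (M : manifold) (c d : chart M) (x : M) : 'M[R]_n :=
  'J (transition c d) (coord c x).

Record vector_field (M : manifold) := VectorField {
  vf_at :> chart M -> M -> 'rV[R]_n;
  vf_change : forall c d x, chart_at c x -> chart_at d x ->
    vf_at d x = vf_at c x *m change c d x;
  vf_smooth : forall c, atlas c -> forall i : 'I_n,
    smooth_on (cod c) (fun u => vf_at c (param c u) 0 i)
}.

Record one_form (M : manifold) := OneForm {
  form_at :> chart M -> M -> 'rV[R]_n;
  form_change : forall c d x, chart_at c x -> chart_at d x ->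
    form_at c x = form_at d x *m (change c d x)^T;
  form_smooth : forall c, atlas c -> forall i : 'I_n,
    smooth_on (cod c) (fun u => form_at c (param c u) 0 i)
}.

(* The index is not fixed in advance: a nondegenerate continuous g has
   constant index on a connected manifold. *)
Record metric (M : manifold) := Metric {
  gram :> chart M -> M -> 'M[R]_n;
  gram_change : forall c d x, chart_at c x -> chart_at d x ->
    gram c x = change c d x *m gram d x *m (change c d x)^T;
  gram_smooth : forall c, atlas c -> forall i j : 'I_n,
    smooth_on (cod c) (fun u => gram c (param c u) i j);
  gram_sym : forall c x, chart_at c x -> (gram c x)^T = gram c x;
  gram_nondegenerate : forall c x, chart_at c x -> gram c x \in unitmx
}.

End Manifolds.

Section LocalCurvature.
Variables (R : realType) (n : nat).

(* G u is the matrix (g_ij) at the point with coordinates u. *)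
Variable G : 'rV[R]_n -> 'M[R]_n.

(* Gamma^k_ij of the Levi-Civita connection *)
Definition christoffel (k i j : 'I_n) (u : 'rV[R]_n) : R :=
  2^-1 * \sum_(l < n) invmx (G u) k l *
    (partial i (fun v => G v j l) u + partial j (fun v => G v i l) u
     - partial l (fun v => G v i j) u).

(* The l-th component of R(e_i, e_j) e_k, where
   R(X, Y) Z = nabla_X nabla_Y Z - nabla_Y nabla_X Z - nabla_[X, Y] Z. *)
Definition riemann13 (i j k l : 'I_n) (u : 'rV[R]_n) : R :=
  partial i (christoffel l j k) u - partial j (christoffel l i k) u
  + \sum_(m < n) (christoffel m j k u * christoffel l i m u
                  - christoffel m i k u * christoffel l j m u).

(* g(R(e_i, e_j) e_k, e_l) *)
Definition riemann04 (i j k l : 'I_n) (u : 'rV[R]_n) : R :=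
  \sum_(m < n) riemann13 i j k m u * G u m l.

End LocalCurvature.

Section Curvature.
Variables (R : realType) (n : nat) (M : manifold R n).

(* D c x is D at x, acting on tangent vectors at x that are given by their
   components in the chart c. *)
Definition tensor4 :=
  chart R n M -> M -> 'rV[R]_n -> 'rV[R]_n -> 'rV[R]_n -> 'rV[R]_n -> R.

Definition pairing (Theta : one_form M) (c : chart R n M) (x : M)
    (X : 'rV[R]_n) : R :=
  (Theta c x *m X^T) 0 0.

Section WithMetric.
Variable g : metric M.

Definition inner (c : chart R n M) (x : M) (X Y : 'rV[R]_n) : R :=
  (X *m g c x *m Y^T) 0 0.

Definition Riem : tensor4 := fun c x X1 X2 X3 X4 =>
  \sum_(i < n) \sum_(j < n) \sum_(k < n) \sum_(l < n)
    riemann04 (fun u => g c (param c u)) i j k l (coord c x)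
    * X1 0 i * X2 0 j * X3 0 k * X4 0 l.

Definition Ricci (c : chart R n M) (x : M) (X2 X3 : 'rV[R]_n) : R :=
  \sum_(i < n) \sum_(l < n)
    invmx (g c x) i l * Riem c x (delta_mx 0 i) X2 X3 (delta_mx 0 l).

Definition scalar_curvature (c : chart R n M) (x : M) : R :=
  \sum_(j < n) \sum_(k < n)
    invmx (g c x) j k * Ricci c x (delta_mx 0 j) (delta_mx 0 k).

Definition Projective : tensor4 := fun c x X1 X2 X3 X4 =>
  Riem c x X1 X2 X3 X4
  - (n%:R - 1)^-1 * (Ricci c x X2 X3 * inner c x X1 X4
                     - Ricci c x X1 X3 * inner c x X2 X4).

Definition Concircular : tensor4 := fun c x X1 X2 X3 X4 =>
  Riem c x X1 X2 X3 X4
  - scalar_curvature c x / (n%:R * (n%:R - 1))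
    * (inner c x X1 X4 * inner c x X2 X3 - inner c x X1 X3 * inner c x X2 X4).

(* the g-dual vector field of Theta *)
Definition sharp (Theta : one_form M) (c : chart R n M) (x : M) : 'rV[R]_n :=
  Theta c x *m invmx (g c x).

(* The condition does not depend on the chart at x. *)
Definition null_at (Theta : one_form M) (x : M) : Prop :=
  forall c, chart_at c x ->
    inner c x (sharp Theta c x) (sharp Theta c x) = 0.

Definition nonnull_at (Theta : one_form M) (x : M) : Prop :=
  ~ null_at Theta x.

End WithMetric.

Definition vanishes_at (D : tensor4) (x : M) : Prop :=
  forall c, chart_at c x -> forall X1 X2 X3 X4, D c x X1 X2 X3 X4 = 0.

Definition venzi_forms (D : tensor4) : set (one_form M) :=
  [set Theta | forall X1 X2 X3 X4 X5 : vector_field M,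
    forall c x, chart_at c x ->
      pairing Theta c x (X1 c x) * D c x (X2 c x) (X3 c x) (X4 c x) (X5 c x)
    + pairing Theta c x (X2 c x) * D c x (X3 c x) (X1 c x) (X4 c x) (X5 c x)
    + pairing Theta c x (X3 c x) * D c x (X1 c x) (X2 c x) (X4 c x) (X5 c x)
    = 0].

Definition nonzero_form (Theta : one_form M) : Prop :=
  exists c x, chart_at c x /\ Theta c x != 0.

Definition associated_form (D : tensor4) (Theta : one_form M) : Prop :=
  venzi_forms D Theta /\ nonzero_form Theta.

(* dim L(M) >= 1, i.e. the vector space L(M) has a nonzero element *)
Definition venzi_space (D : tensor4) : Prop :=
  exists Theta : one_form M, associated_form D Theta.

End Curvature.

(* Main.v *)
(* Both parts follow from an identity at each point.  Let V be the dual of Pi,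
   let n be the dimension, S the Ricci tensor, k the scalar curvature and
   Z = S - (k/n) g.  The trace of P over its outer slots vanishes, so tracing the
   Venzi identity for P gives P(X, Y, Z', V) = 0, that is
     R(X, Y, Z', V) = (S(Y, Z') Pi(X) - S(X, Z') Pi(Y)) / (n - 1).
   One more trace gives S(X, V) = (k/n) Pi(X), i.e. Z(X, V) = 0, and tracing the
   Venzi identity over another pair of slots gives Pi(X) Z(Y, T) = Pi(Y) Z(X, T).
   Where Pi does not vanish, Z is therefore phi Pi (x) Pi.  As W - P is linear in
   Z, the cyclic sum of Pi (x) (W - P) is zero and W satisfies the Venzi identity.
   If Pi(V) <> 0, then Z(V, V) = 0 forces Z = 0, so that P = W; contracting the
   Venzi identity with V leaves Pi(V) W = 0, by the pair symmetry of W.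

   The identity is assumed for global vector fields, so smooth bump functions are
   needed to obtain it for arbitrary tangent vectors; the symmetries of the
   Riemann tensor rest on the commutation of second partial derivatives. *)

From mathcomp Require Import all_boot all_order all_algebra.
From mathcomp Require Import all_classical all_reals all_analysis.
From mathcomp Require Import ring lra.
(* Defs comes last: its [coord] must shadow the one of [vector]. *)
Require Import Defs.

Set Implicit Arguments.
Unset Strict Implicit.
Unset Printing Implicit Defensive.

Import Order.TTheory GRing.Theory Num.Theory.
Import numFieldNormedType.Exports.

Local Open Scope classical_set_scope.
Local Open Scope ring_scope.

(** * Traces and curvature-like tensors on a vector space *)

Section BilinearTrace.
Variables (F : fieldType) (n : nat).
Local Notation V := 'rV[F]_n.
Implicit Types (a b X Y : V) (f : V -> F) (B : V -> V -> F).

Definition linform f := forall k X Y, f (k *: X + Y) = k * f X + f Y.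

Lemma linform0 f : linform f -> f 0 = 0.
Proof. by move=> lf; have := lf (-1) 0 0; rewrite scaler0 addr0 mulN1r addNr. Qed.

Lemma linformZ f k X : linform f -> f (k *: X) = k * f X.
Proof. by move=> lf; rewrite -[k *: X]addr0 lf linform0// addr0. Qed.

Lemma linform_sum f m (X : 'I_m -> V) (k : 'I_m -> F) : linform f ->
  f (\sum_i k i *: X i) = \sum_i k i * f (X i).
Proof.
move=> lf; elim/big_rec2: _ => [|i y x _ <-]; first exact: linform0.
by rewrite lf.
Qed.

Definition covec (p X : V) : F := (p *m X^T) 0 0.

Lemma covecE p X : covec p X = \sum_i p 0 i * X 0 i.
Proof. by rewrite /covec mxE; apply: eq_bigr => i _; rewrite mxE. Qed.

Lemma covec_linform p : linform (covec p).
Proof. by move=> k X Y; rewrite /covec linearP/= mulmxDr -scalemxAr !mxE. Qed.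

Variable G : 'M[F]_n.
Hypotheses (Gsym : G^T = G) (Gunit : G \in unitmx).

Definition ip X Y : F := (X *m G *m Y^T) 0 0.

Lemma ip_covec X Y : ip X Y = covec (X *m G) Y. Proof. by []. Qed.

Lemma ipC X Y : ip X Y = ip Y X.
Proof.
by rewrite /ip -[in LHS](trmxK (X *m G *m Y^T)) [LHS]mxE !trmx_mul trmxK Gsym mulmxA.
Qed.

Lemma ip_linr X : linform (ip X). Proof. exact: covec_linform. Qed.

Definition tr B : F :=
  \sum_(i < n) \sum_(l < n) invmx G i l * B (delta_mx 0 i) (delta_mx 0 l).

Lemma invmx_sym i j : invmx G i j = invmx G j i.
Proof. by rewrite -[in LHS]Gsym -trmx_inv mxE. Qed.

Lemma eq_tr B C : (forall X Y, B X Y = C X Y) -> tr B = tr C.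
Proof. by move=> e; apply: eq_bigr => i _; apply: eq_bigr => j _; rewrite e. Qed.

Lemma trD B C : tr (fun X Y => B X Y + C X Y) = tr B + tr C.
Proof.
rewrite /tr -big_split; apply: eq_bigr => i _; rewrite -big_split.
by apply: eq_bigr => j _; rewrite mulrDr.
Qed.

Lemma trZ k B : tr (fun X Y => k * B X Y) = k * tr B.
Proof.
rewrite /tr big_distrr; apply: eq_bigr => i _; rewrite /= big_distrr.
by apply: eq_bigr => j _; rewrite /= mulrCA.
Qed.

Lemma trN B : tr (fun X Y => - B X Y) = - tr B.
Proof. by rewrite -mulN1r -trZ; apply: eq_tr => X Y; rewrite mulN1r. Qed.

Lemma trC B : tr (fun X Y => B Y X) = tr B.
Proof.
rewrite /tr exchange_big; apply: eq_bigr => i _; apply: eq_bigr => j _ /=.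
by rewrite invmx_sym.
Qed.

(** Contracting a covector with a linear form evaluates the form at the dual vector [p *m invmx G].
    Tracing the Venzi identity thereby inserts the dual of the associated form. *)
Lemma tr_covec p f : linform f ->
  tr (fun X Y => covec p X * f Y) = f (p *m invmx G).
Proof.
move=> lf; rewrite [p *m _]row_sum_delta linform_sum// /tr exchange_big /=.
apply: eq_bigr => j _; rewrite mxE big_distrl /=; apply: eq_bigr => i _.
rewrite covecE (bigD1 i)//= big1 ?addr0 => [|k ki]; last by rewrite mxE (negbTE ki) andbF mulr0.
by rewrite mxE !eqxx/= mulr1 mulrCA mulrA.
Qed.

Lemma tr_ip X f : linform f -> tr (fun Y Z => ip X Y * f Z) = f X.
Proof. by move=> lf; rewrite (tr_covec (X *m G)) // mulmxK. Qed.

Lemma tr_metric : tr ip = n%:R.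
Proof.
transitivity (\tr (invmx G *m G)); last by rewrite mulVmx// mxtrace1.
rewrite /tr /mxtrace; apply: eq_bigr => i _; rewrite mxE; apply: eq_bigr => j _.
by congr (_ * _); rewrite ipC /ip -rowE trmx_delta -colE !mxE.
Qed.

Lemma linform_tr (D : V -> V -> V -> F) :
  (forall X Z, linform (fun Y => D X Y Z)) -> linform (fun Y => tr (fun X Z => D X Y Z)).
Proof. by move=> lD k Y Y'; rewrite -trZ -trD; apply: eq_tr => X Z; rewrite lD. Qed.

End BilinearTrace.

(** * Algebraic curvature tensors subject to the Venzi identity *)

Section CurvatureAlgebra.
Variables (F : realFieldType) (n : nat).
Local Notation V := 'rV[F]_n.
Variables (G : 'M[F]_n) (K : V -> V -> V -> V -> F).
Hypotheses (Gsym : G^T = G) (Gunit : G \in unitmx) (n_ge3 : (2 < n)%N).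
Hypothesis K_lin : forall Y Z T, linform (fun X => K X Y Z T).
Hypothesis K_anti12 : forall X Y Z T, K X Y Z T = - K Y X Z T.
Hypothesis K_anti34 : forall X Y Z T, K X Y Z T = - K X Y T Z.
Hypothesis K_bianchi : forall X Y Z T, K X Y Z T + K Y Z X T + K Z X Y T = 0.

Local Notation ip := (ip G).
Local Notation tr := (tr G).

(** The Bianchi identity is taken for the four cyclic shifts of the arguments; the antisymmetries
    identify their terms up to sign, and the claim becomes linear arithmetic. *)
Lemma curv_pair X Y Z T : K X Y Z T = K Z T X Y.
Proof.
have := K_bianchi X Y Z T; have := K_bianchi Y Z T X.
have := K_bianchi Z T X Y; have := K_bianchi T X Y Z.
have := (K_anti34 Y Z X T, K_anti12 Z X Y T, K_anti34 Z X T Y, K_anti12 X Z T Y).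
have := (K_anti12 T Y Z X, K_anti34 Y T Z X, K_anti12 T X Y Z, K_anti34 X T Y Z).
have := (K_anti34 Z T X Y, K_anti34 X Y Z T, K_anti34 T X Y Z, K_anti12 Y Z T X).
move=> [[[? ?] ?] ?] [[[? ?] ?] ?] [[[? ?] ?] ?] ? ? ? ?.
lra.
Qed.

Definition ricci X Y : F := tr (fun A B => K A X Y B).
Definition scal : F := tr ricci.
Definition proj_curv X1 X2 X3 X4 : F := K X1 X2 X3 X4
  - (n%:R - 1)^-1 * (ricci X2 X3 * ip X1 X4 - ricci X1 X3 * ip X2 X4).
Definition conc_curv X1 X2 X3 X4 : F := K X1 X2 X3 X4
  - scal / (n%:R * (n%:R - 1)) * (ip X1 X4 * ip X2 X3 - ip X1 X3 * ip X2 X4).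

Let N1 : n%:R - 1 != 0 :> F. Proof. by rewrite subr_eq0 pnatr_eq1; case: n n_ge3 => [|[]]. Qed.
Let N0 : n%:R != 0 :> F. Proof. by rewrite pnatr_eq0; case: n n_ge3. Qed.

(** Linearity passes from the first slot to the others through the symmetries. *)
Lemma curv_lin2 X Z T : linform (fun Y => K X Y Z T).
Proof. by move=> k Y Y'; rewrite !(K_anti12 X) K_lin; ring. Qed.

Lemma curv_lin3 X Y T : linform (fun Z => K X Y Z T).
Proof. by move=> k Z Z'; rewrite !(curv_pair X Y) K_lin. Qed.

Lemma curv_lin4 X Y Z : linform (K X Y Z).
Proof. by move=> k T T'; rewrite !(K_anti34 X Y Z) curv_lin3; ring. Qed.

Lemma ricciC X Y : ricci X Y = ricci Y X.
Proof.
rewrite /ricci -(trC Gsym); apply: eq_tr => A B.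
by rewrite curv_pair K_anti12 K_anti34; ring.
Qed.

Lemma ricci_linl Y : linform (ricci^~ Y).
Proof. by apply: (@linform_tr _ _ G (fun A X B => K A X Y B)) => A B; exact: curv_lin2. Qed.

Lemma ricci_linr X : linform (ricci X).
Proof. by move=> k Y Y'; rewrite !(ricciC X) ricci_linl. Qed.

Variable p : V.
Hypothesis p_neq0 : p != 0.
Local Notation th := (covec p).
Let v : V := p *m invmx G.
Hypothesis venziP : forall X1 X2 X3 X4 X5,
  th X1 * proj_curv X2 X3 X4 X5 + th X2 * proj_curv X3 X1 X4 X5
  + th X3 * proj_curv X1 X2 X4 X5 = 0.

Lemma proj_curv_anti12 X1 X2 X3 X4 : proj_curv X1 X2 X3 X4 = - proj_curv X2 X1 X3 X4.
Proof. by rewrite /proj_curv K_anti12; ring. Qed.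

(** The coefficient 1/(n-1) is the one that makes this trace vanish: the two correction terms
    contribute n S and -S. *)
Lemma tr14_proj X Y : tr (fun A B => proj_curv A X Y B) = 0.
Proof.
rewrite /proj_curv trD trN trZ trD trN trZ tr_metric//.
have -> : tr (fun A B => ricci A Y * ip X B) = ricci X Y.
  rewrite -(trC Gsym) -[RHS](tr_ip Gunit _ (ricci_linl Y)).
  by apply: eq_tr => A B; rewrite mulrC.
by rewrite -/(ricci X Y); field.
Qed.

Lemma proj_curv_lin4 X Y Z : linform (proj_curv X Y Z).
Proof.
by move=> k T T'; rewrite /proj_curv curv_lin4 !ip_linr; ring.
Qed.

Lemma ip_sharp X : ip X v = th X.
Proof. by rewrite (ipC Gsym) ip_covec /v mulmxKV. Qed.

(** The Venzi identity is traced over its first and last arguments. Two of the three terms are, up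
    to sign, the vanishing trace [tr14_proj]; the third is evaluated by [tr_covec]. *)
Lemma proj_curv_sharp X Y Z : proj_curv X Y Z v = 0.
Proof.
have : tr (fun A B => th A * proj_curv X Y Z B + th X * proj_curv Y A Z B
    + th Y * proj_curv A X Z B) = 0.
  (* Zero is written as a multiple of a trace, so that [eq_tr] compares the integrands. *)
  by rewrite -[RHS](mul0r (tr ip)) -trZ; apply: eq_tr => A B; rewrite venziP mul0r.
rewrite !trD !trZ tr14_proj (tr_covec _ _ (proj_curv_lin4 X Y Z)) -/v.
rewrite (eq_tr _ (fun A B => proj_curv_anti12 Y A Z B)) trN tr14_proj.
by rewrite oppr0 !mulr0 !addr0.
Qed.

Lemma curv_sharp X Y Z :
  K X Y Z v = (n%:R - 1)^-1 * (ricci Y Z * th X - ricci X Z * th Y).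
Proof.
by have /eqP := proj_curv_sharp X Y Z; rewrite /proj_curv !ip_sharp subr_eq0 => /eqP.
Qed.

(** Tracing [curv_sharp] over [Y] and [Z] gives an equation with [ricci X v] on both sides;
    collecting these terms turns the factor n - 1 into n. *)
Lemma ricci_sharp X : ricci X v = scal / n%:R * th X.
Proof.
have h : ricci X v = (n%:R - 1)^-1 * (scal * th X - ricci X v).
  transitivity (tr (fun Y Z => K X Y Z v)).
    by rewrite /ricci; apply: eq_tr => A B; rewrite K_anti12 K_anti34; ring.
  rewrite (eq_tr _ (fun Y Z => curv_sharp X Y Z)) trZ trD trN.
  congr (_ * (_ - _)).
    by rewrite mulrC -trZ; apply: eq_tr => A B; rewrite mulrC.
  rewrite /v -(tr_covec _ _ (ricci_linr X)); apply: eq_tr => A B.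
  by rewrite mulrC.
apply: (mulfI N0); rewrite mulrA mulrCA mulfV// mulr1.
have : (n%:R - 1) * ricci X v = scal * th X - ricci X v by rewrite {1}h mulVKf.
by move=> e; rewrite -(subrK (ricci X v) (scal * _)) -e; ring.
Qed.

(** The trace-free Ricci tensor. *)
Let Z X Y := ricci X Y - scal / n%:R * ip X Y.

Let tf_sharp X : Z X v = 0.
Proof. by rewrite /Z ricci_sharp ip_sharp subrr. Qed.

Let tfC X Y : Z X Y = Z Y X. Proof. by rewrite /Z ricciC (ipC Gsym). Qed.

(** By [ricci_sharp] the metric terms of P acquire the factor [scal / n%:R], which completes the
    Ricci terms to [Z]. *)
Lemma curv_sharp3 X Y T :
  proj_curv X Y v T = - (n%:R - 1)^-1 * (Z Y T * th X - Z X T * th Y).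
Proof.
rewrite /proj_curv K_anti34 curv_sharp !ricci_sharp /Z.
by field; rewrite N0 N1.
Qed.

(** The trace over the two middle slots, unlike that over the outer ones, detects how far the metric
    is from being Einstein at the point. *)
Lemma tr13_proj X Y : tr (fun A B => proj_curv X A B Y) = n%:R / (n%:R - 1) * Z X Y.
Proof.
rewrite /proj_curv trD trN trZ trD trN.
have -> : tr (fun A B => K X A B Y) = ricci X Y.
  by rewrite /ricci; apply: eq_tr => A B; rewrite curv_pair K_anti12 K_anti34 curv_pair; ring.
have -> : tr (fun A B => ricci A B * ip X Y) = ip X Y * scal.
  by rewrite -trZ; apply: eq_tr => A B; rewrite mulrC.
have -> : tr (fun A B => ricci X B * ip A Y) = ricci X Y.
  rewrite -[RHS](tr_ip Gunit _ (ricci_linr X)).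
  by apply: eq_tr => A B; rewrite mulrC (ipC Gsym).
by rewrite /Z; field; rewrite N0 N1.
Qed.

(** The Venzi identity is now traced over its first and fourth arguments. The coefficients -1/(n-1)
    from [curv_sharp3] and n/(n-1) from [tr13_proj] add up to 1. *)
Lemma th_tf X Y T : th X * Z Y T = th Y * Z X T.
Proof.
have : tr (fun A B => th A * proj_curv X Y B T + th X * proj_curv Y A B T
    + th Y * proj_curv A X B T) = 0.
  by rewrite -[RHS](mul0r (tr ip)) -trZ; apply: eq_tr => A B; rewrite venziP mul0r.
rewrite !trD !trZ tr13_proj (eq_tr _ (fun A B => proj_curv_anti12 A X B T)) trN tr13_proj.
rewrite (@tr_covec _ _ G p (fun B => proj_curv X Y B T)); last first.
  by move=> k U U'; rewrite /proj_curv curv_lin3 !ricci_linr; ring.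
rewrite -/v curv_sharp3 => h.
apply/eqP; rewrite -subr_eq0 -[X in _ == X]h; apply/eqP.
by field; rewrite N1.
Qed.

Lemma exists_th1 : exists u, th u = 1.
Proof.
have /rV0Pn[i pi] := p_neq0.
exists ((p 0 i)^-1 *: delta_mx 0 i).
rewrite (linformZ _ _ (@covec_linform _ _ p)) covecE (bigD1 i)//= big1 => [|j ji].
  by rewrite mxE !eqxx mulr1 addr0 mulVf.
by rewrite mxE (negbTE ji) andbF mulr0.
Qed.

(** A symmetric form obeying [th_tf] has rank at most one: two evaluations at a [u] with [th u = 1]
    express it through [Z u u]. *)
Lemma tf_ricciE : exists phi, forall X Y, Z X Y = phi * th X * th Y.
Proof.
have [u u1] := exists_th1; exists (Z u u) => X Y.
have e W Y' : Z W Y' = th W * Z u Y' by rewrite -[LHS]mul1r -u1 th_tf.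
by rewrite e tfC e; ring.
Qed.

Lemma conc_proj X1 X2 X3 X4 : conc_curv X1 X2 X3 X4 = proj_curv X1 X2 X3 X4
  + (n%:R - 1)^-1 * (Z X2 X3 * ip X1 X4 - Z X1 X3 * ip X2 X4).
Proof. by rewrite /conc_curv /proj_curv /Z; field; rewrite N0 N1. Qed.

(** Once [Z] is a multiple of the square of [th], the correction terms from [conc_proj] cancel in
    pairs in the cyclic sum. *)
Lemma conc_curv_venzi X1 X2 X3 X4 X5 :
  th X1 * conc_curv X2 X3 X4 X5 + th X2 * conc_curv X3 X1 X4 X5
  + th X3 * conc_curv X1 X2 X4 X5 = 0.
Proof.
have [phi Zphi] := tf_ricciE.
rewrite !conc_proj !Zphi -[RHS](venziP X1 X2 X3 X4 X5); ring.
Qed.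

Lemma conc_curv_nonnull X1 X2 X3 X4 : ip v v != 0 -> conc_curv X1 X2 X3 X4 = 0.
Proof.
move=> vv; have [phi Zphi] := tf_ricciE.
(* [Z u v] vanishes and equals phi times [th v], where [th v] is [ip v v]. *)
have phi0 : phi = 0.
  have [u u1] := exists_th1; have := tf_sharp u.
  rewrite Zphi u1 mulr1 -ip_sharp => /eqP; rewrite mulf_eq0 (negbTE vv) orbF.
  by move/eqP.
have e Y1 Y2 Y3 Y4 : conc_curv Y1 Y2 Y3 Y4 = proj_curv Y1 Y2 Y3 Y4.
  by rewrite conc_proj !Zphi phi0; ring.
(* Pair symmetry moves the [v] of [proj_curv_sharp] from the fourth slot to the second, and
   antisymmetry to the first; this removes two terms of the Venzi identity. *)
have conc_pair Y1 Y2 Y3 Y4 : conc_curv Y1 Y2 Y3 Y4 = conc_curv Y3 Y4 Y1 Y2.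
  by rewrite /conc_curv curv_pair !(ipC Gsym Y3) !(ipC Gsym Y4); ring.
have h := conc_curv_venzi v X1 X2 X3 X4.
have z Y1 Y2 Y3 : conc_curv Y1 v Y2 Y3 = 0 by rewrite conc_pair e proj_curv_sharp.
have z' Y1 Y2 Y3 : conc_curv v Y1 Y2 Y3 = 0.
  by rewrite e proj_curv_anti12 -e z oppr0.
move: h; rewrite z z' !mulr0 !addr0 -ip_sharp => /eqP.
by rewrite mulf_eq0 (negbTE vv) => /eqP.
Qed.

End CurvatureAlgebra.

(** * Commutation of second derivatives *)

Section Schwarz.
Variables (R : realType) (V : normedModType R).
Implicit Types (f g : V -> R) (a v w : V).

(** The first-order expansion of [f] at [a] is also one of [g], and an expansion determines the
    differential. *)
Lemma near_eq_differentiable (W : normedModType R) (f g : V -> W) a :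
  (\near a, f a = g a) -> differentiable f a -> differentiable g a.
Proof.
move=> fg df; have [cf hf] := (diff_locallyP _ _).1 df.
have hg : g \o shift a = cst (g a) + 'd f a +o_ 0 id.
  apply/eqaddoP => _ /posnumP[e].
  move/eqaddoP : hf => /(_ e%:num) /(_ [gt0 of e%:num]) hf.
  have fg0 : \forall h \near (0 : V), f (h + a) = g (h + a).
    by move: fg; rewrite (near_shift 0)/= subr0.
  move: fg0 hf; apply: filterS2 => h fgh.
  rewrite /= -![(_ + _ : _ -> _) _]/(_ + _) -![(- _ : _ -> _) _]/(- _).
  by rewrite -(nbhs_singleton fg) -![(_ + _ : _ -> _) _]/(_ + _) /= fgh.
apply/diff_locallyP; rewrite (diff_unique cf hg) //.
Qed.

(** Along a line, the directional derivative becomes the derivative of a function of one real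
    variable, to which the mean value theorem applies. *)
Lemma is_derive_line f v b (t : R) : differentiable f (t *: v + b) ->
  is_derive t (1 : R) (fun s : R => f (s *: v + b)) ('D_v f (t *: v + b)).
Proof.
move=> df; pose g (s : R) := s *: v + b.
have dg : is_diff t g (fun s => s *: v + 0) by apply: is_diffD.
have dfg : differentiable (f \o g) t by exact: differentiable_comp.
split; first exact/diff_derivable.
rewrite (deriveE _ dfg) (@diff_comp _ _ _ _ g f t)//= (deriveE _ df) diff_val.
by rewrite scale1r addr0.
Qed.

(* The mean value theorem turns the second difference into h times a first
   difference of D_v f, which differentiability of D_v f at a approximates. *)
Lemma second_difference f a v w : (\near a, differentiable f a) ->
  differentiable ('D_v f) a ->
  forall e : R, 0 < e -> \forall h \near 0^'+,
    `|f (h *: v + (h *: w + a)) - f (h *: w + a) - f (h *: v + a) + f a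
      - h ^+ 2 * 'D_w ('D_v f) a| <= e * h ^+ 2.
Proof.
move=> df dvf e e0; rewrite (deriveE _ dvf).
set L := 'd _ a; pose C := `|v| + `|w| + 1.
have C0 : 0 < C by rewrite ltr_pwDr// addr_ge0.
(* The remainder will be at most e/(2C) times a norm bounded by hC, so that each use of [est] below
   costs e/2 times h, and two uses are made. *)
have e'0 : 0 < e / (2 * C) by rewrite divr_gt0// mulr_gt0.
have /eqaddoP/(_ _ e'0) := diff_locally dvf.
rewrite -/L => /nbhs_ballP[r /= r0 hr].
move: df => /nbhs_ballP[r' /= r'0 hr'].
pose d := Num.min r r' / C.
have d0 : 0 < d by rewrite divr_gt0// lt_min r0.
near=> h.
have h0 : 0 < h by near: h; exact: nbhs_right_gt.
have hd : h < d by near: h; exact: nbhs_right_lt.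
have bnd c s : 0 <= c <= h -> 0 <= s <= h -> `|c *: v + s *: w| <= h * (`|v| + `|w|).
  move=> /andP[c0 ch] /andP[s0 sh]; rewrite (le_trans (ler_normD _ _))// mulrDr !normrZ.
  by rewrite !ger0_norm// lerD// ler_wpM2r.
have bnd' c s : 0 <= c <= h -> 0 <= s <= h -> `|c *: v + s *: w| < Num.min r r'.
  move=> hc hs; apply: (le_lt_trans (bnd _ _ hc hs)).
  apply: (@le_lt_trans _ _ (h * C)); first by rewrite ler_pM2l// lerDl.
  by rewrite -ltr_pdivlMr.
have hh : 0 <= h <= h by rewrite lexx ltW.
have h00 : 0 <= (0 : R) <= h by rewrite lexx ltW.
have dfl c s : 0 <= c <= h -> 0 <= s <= h -> differentiable f (c *: v + (s *: w + a)).
  move=> hc hs; apply: hr'; rewrite -ball_normE /ball_ /= (addrA _ _ a) (addrC _ a).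
  rewrite opprD addrA subrr add0r normrN.
  by have := bnd' _ _ hc hs; rewrite lt_min => /andP[].
have est c s : 0 <= c <= h -> 0 <= s <= h ->
    `|'D_v f (c *: v + (s *: w + a)) - 'D_v f a - L (c *: v + s *: w)| <= e / 2 * h.
  move=> hc hs; have := hr (c *: v + s *: w).
  rewrite -ball_normE /ball_ /= sub0r normrN => /(_ _)/wrap[].
    by have := bnd' _ _ hc hs; rewrite lt_min => /andP[].
  rewrite -![(_ + _ : _ -> _) _]/(_ + _) -![(- _ : _ -> _) _]/(- _) /=.
  rewrite -![(_ + _ : _ -> _) _]/(_ + _) /= /cst opprD !addrA => /le_trans; apply.
  apply: (@le_trans _ _ (e / (2 * C) * (h * C))).
    by rewrite ler_pM2l// (le_trans (bnd _ _ hc hs))// ler_pM2l// lerDl.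
  by rewrite le_eqVlt; apply/orP; left; apply/eqP; field; rewrite gt_eqF.
pose F (t : R) := f (t *: v + (h *: w + a)) - f (t *: v + a).
have dF t : 0 <= t <= h ->
    is_derive t (1 : R) F ('D_v f (t *: v + (h *: w + a)) - 'D_v f (t *: v + a)).
  move=> ht; apply: is_deriveB; apply: is_derive_line; first exact: dfl.
  by have := dfl _ _ ht h00; rewrite scale0r add0r.
have [||c cin] := @MVT R F (fun t => 'D_v f (t *: v + (h *: w + a)) - 'D_v f (t *: v + a)) 0 h h0.
- by move=> t; rewrite in_itv/= => /andP[t0 t1]; apply: dF; rewrite !ltW.
- apply: derivable_within_continuous => t; rewrite in_itv/= => ht.
  by have [] := dF _ ht.
rewrite subr0 /F scale0r !add0r => MV.
have hc : 0 <= c <= h by move: cin; rewrite in_itv/= => /andP[c0 c1]; rewrite !ltW.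
have e1 := est _ _ hc hh; have e2 := est _ _ hc h00.
rewrite scale0r add0r addr0 in e2.
rewrite linearD [L (h *: w)]linearZ /= in e1.
set A := 'D_v f (_ + (_ + _)) in e1 MV *; set B := 'D_v f (_ + _) in e2 MV *.
(* The intermediate point [c] is unknown, but its contribution [L (c *: v)] is the same in both
   expansions and cancels. *)
have -> : f (h *: v + (h *: w + a)) - f (h *: w + a) - f (h *: v + a) + f a - h ^+ 2 * L w
   = ((A - 'D_v f a - (L (c *: v) + h * L w)) - (B - 'D_v f a - L (c *: v))) * h.
  transitivity ((A - B) * h - h ^+ 2 * L w); last by ring.
  by rewrite -MV; ring.
rewrite normrM (gtr0_norm h0) expr2 mulrA ler_pM2r//.
rewrite (le_trans (ler_normB _ _))// (le_trans (lerD e1 e2))//.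
by rewrite -mulrDl -splitr.
Unshelve. all: by end_near. Qed.

(** Both [x] and [y] lie within e/2 of d/k. *)
Lemma dist_le_scaled (d k x y e : R) : 0 < k ->
  `|d - k * x| <= e / 2 * k -> `|d - k * y| <= e / 2 * k -> `|x - y| <= e.
Proof.
move=> k0 dx dy; rewrite -(ler_pM2r k0) -[k in leLHS](gtr0_norm k0) -normrM.
rewrite [_ * k](_ : _ = (d - k * y) - (d - k * x)); last by ring.
by rewrite (le_trans (ler_normB _ _))// (le_trans (lerD dy dx))// -mulrDl -splitr.
Qed.

(* Both sides are the limit of the second difference, symmetric in v and w,
   divided by h ^+ 2. *)
Lemma derive_commute f a v w : (\near a, differentiable f a) ->
  differentiable ('D_v f) a -> differentiable ('D_w f) a ->
  'D_w ('D_v f) a = 'D_v ('D_w f) a.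
Proof.
move=> df dv dw; apply/eqP; rewrite -subr_eq0 -normr_le0; apply/ler_addgt0Pr => e e0.
rewrite add0r.
have e20 : 0 < e / 2 by rewrite divr_gt0.
have S1 := second_difference w df dv e20; have S2 := second_difference v df dw e20.
have [h [[h1 h2] h0]] : exists h : R, _ :=
  @filter_ex _ _ (at_right_proper_filter (0 : R)) _ (filterI (filterI S1 S2) (nbhs_right_gt 0)).
have h20 : 0 < h ^+ 2 by rewrite exprn_gt0.
rewrite addrCA [_ - f (h *: v + a) - _]addrAC in h2.
exact: (dist_le_scaled h20 h1 h2).
Qed.

End Schwarz.

(** * Calculus of smooth functions *)

Section PartialDerivatives.
Variables (R : realType) (n : nat).
Implicit Types (f g : 'rV[R]_n -> R) (u : 'rV[R]_n) (U : set 'rV[R]_n).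

Lemma partialE f i u : differentiable f u -> partial i f u = 'd f u (delta_mx 0 i).
Proof. exact: deriveE. Qed.

Lemma partial_near i f g u : (\near u, f u = g u) -> partial i f u = partial i g u.
Proof. exact: near_eq_derive. Qed.

Lemma partial_cst i (c : R) u : partial i (cst c) u = 0.
Proof. exact: derive_cst. Qed.

Lemma partialD i f g u : differentiable f u -> differentiable g u ->
  partial i (f \+ g) u = partial i f u + partial i g u.
Proof. by move=> df dg; rewrite /partial deriveD//; exact: diff_derivable. Qed.

Lemma partialM i f g u : differentiable f u -> differentiable g u ->
  partial i (f \* g) u = partial i f u * g u + f u * partial i g u.
Proof.
move=> df dg; rewrite /partial deriveM; try exact: diff_derivable.
by rewrite addrC; congr (_ + _); rewrite mulrC.
Qed.

Lemma partial_sum i m (F : 'I_m -> 'rV[R]_n -> R) u :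
  (forall j, differentiable (F j) u) ->
  partial i (fun v => \sum_j F j v) u = \sum_j partial i (F j) u.
Proof.
move=> dF; rewrite /partial -derive_sum; last by move=> j; exact: diff_derivable.
by congr ('D_ _ _ _); apply/funext => v; rewrite fct_sumE.
Qed.

Lemma differentiable_rV m (phi : 'rV[R]_n -> 'rV[R]_m) u :
  (forall j, differentiable (fun v => phi v 0 j) u) -> differentiable phi u.
Proof.
move=> dphi.
have -> : phi = \sum_j (fun v => phi v 0 j *: (delta_mx 0 j : 'rV[R]_m)).
  by apply/funext => v; rewrite fct_sumE -row_sum_delta.
by apply: differentiable_sum => j; exact: differentiableZl.
Qed.

Lemma jacobianE m (phi : 'rV[R]_n -> 'rV[R]_m) u i j :
  (forall j, differentiable (fun v => phi v 0 j) u) ->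
  'J phi u i j = partial i (fun v => phi v 0 j) u.
Proof.
move=> /differentiable_rV dphi; have := deriveEjacobian (delta_mx 0 i) dphi.
rewrite -rowE derive_mx; last exact: diff_derivable.
by move=> /rowP/(_ j); rewrite !mxE.
Qed.

Lemma partial_comp m (phi : 'rV[R]_n -> 'rV[R]_m) (f : 'rV[R]_m -> R) i u :
  (forall j, differentiable (fun v => phi v 0 j) u) -> differentiable f (phi u) ->
  partial i (f \o phi) u =
  \sum_j partial j f (phi u) * partial i (fun v => phi v 0 j) u.
Proof.
move=> dphi df; have dphi' := differentiable_rV dphi.
rewrite partialE; last exact: differentiable_comp.
rewrite diff_comp//= -(deriveE _ dphi') deriveEjacobian// -rowE.
rewrite [row i _]row_sum_delta linear_sum; apply: eq_bigr => j _.
by rewrite linearZ/= -(deriveE _ df) mulrC mxE jacobianE.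
Qed.

(* k-fold differentiability; unlike for C^k, there is no condition for k = 0. *)
Fixpoint Ck (k : nat) U f : Prop :=
  if k is k'.+1 then
    (forall u, U u -> differentiable f u) /\ (forall i, Ck k' U (partial i f))
  else True.

(** [iter_partial] applies the last index of its list first, and [Ck] takes derivatives from the
    inside out, so lists grow at their right end. The recursive form supports the inductions on k
    that follow. *)
Lemma smooth_onP U f : smooth_on U f <-> forall k, Ck k U f.
Proof.
split=> [sf k|Cf s].
  elim: k f sf => // k IHk f sf; split; first exact: (sf [::]).
  by move=> i; apply: IHk => s; have := sf (rcons s i); rewrite /iter_partial foldr_rcons.
have := Cf (size s).+1; elim/last_ind: s f {Cf} => [|s i IHs] f; first by case.
by rewrite size_rcons => -[_ /(_ i)/IHs]; rewrite /iter_partial foldr_rcons.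
Qed.

Lemma CkW k U f : Ck k.+1 U f -> Ck k U f.
Proof.
elim: k f => // k IHk f [df Cf]; split=> // i.
exact/IHk/Cf.
Qed.

(** Derivatives at a point of an open set depend only on nearby values. The product and chain rules
    hold on [U] alone, so the closure lemmas substitute them for a partial derivative through this
    result. *)
Lemma eq_Ck k U f g : open U -> (forall u, U u -> f u = g u) -> Ck k U f -> Ck k U g.
Proof.
move=> oU; elim: k f g => // k IHk f g fg [df Cf].
have fgn u : U u -> \near u, f u = g u.
  by move=> Uu; apply: filterS (open_nbhs_nbhs (conj oU Uu)) => v; exact: fg.
split=> [u Uu|i]; first exact: near_eq_differentiable (fgn _ Uu) (df u Uu).
by apply: IHk (Cf i) => u Uu; apply: partial_near; exact: fgn.
Qed.

Lemma Ck_cst k U (c : R) : Ck k U (cst c).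
Proof.
elim: k c => // k IHk c; split=> [u _|i]; first exact: differentiable_cst.
have -> : partial i (cst c) = cst 0 by apply/funext => u; rewrite partial_cst.
exact: IHk.
Qed.

Section OpenDomain.
Variable U : set 'rV[R]_n.
Hypothesis oU : open U.

Lemma CkD k f g : Ck k U f -> Ck k U g -> Ck k U (f \+ g).
Proof.
elim: k f g => // k IHk f g [df Cf] [dg Cg].
split=> [u Uu|i]; first exact: differentiableD (df _ Uu) (dg _ Uu).
apply: (eq_Ck oU (f := partial i f \+ partial i g)) => [u Uu|]; last first.
  by apply: IHk; [exact: Cf|exact: Cg].
by rewrite partialD//; [exact: df|exact: dg].
Qed.

(** The Leibniz rule keeps one factor undifferentiated, so the induction also uses [f] and [g] at
    the lower order, by [CkW]. *)
Lemma CkM k f g : Ck k U f -> Ck k U g -> Ck k U (f \* g).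
Proof.
elim: k f g => // k IHk f g Cf' Cg'; have [[df Cf] [dg Cg]] := (Cf', Cg').
split=> [u Uu|i]; first exact: differentiableM (df _ Uu) (dg _ Uu).
apply: (eq_Ck oU (f := (partial i f \* g) \+ (f \* partial i g))) => [u Uu|].
  by rewrite partialM//; [exact: df|exact: dg].
by apply: CkD; apply: IHk; do ?[exact: CkW|exact: Cf|exact: Cg].
Qed.

Lemma Ck_sum k m (F : 'I_m -> 'rV[R]_n -> R) :
  (forall j, Ck k U (F j)) -> Ck k U (fun u => \sum_j F j u).
Proof.
move=> CF; have -> : (fun u => \sum_j F j u) = \big[(fun f g => f \+ g)/cst 0]_j F j.
  by apply/funext => u; elim/big_rec2: _ => // j x y _ ->.
by elim/big_ind: _ => // [|f g]; [exact: Ck_cst|exact: CkD].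
Qed.

End OpenDomain.

Lemma Ck_coord k U j : Ck k U (fun u => u 0 j).
Proof.
case: k => // k; split=> [u _|i]; first exact: differentiable_coord.
have -> : partial i (fun u => u 0 j) = cst ((delta_mx 0 i : 'rV[R]_n) 0 j).
  apply/funext => u; rewrite /partial; have := @derive_id R _ u (delta_mx 0 i).
  rewrite derive_mx; last exact: derivable_id.
  by move=> /rowP/(_ j); rewrite mxE.
exact: Ck_cst.
Qed.

End PartialDerivatives.

(** The chain rule writes each partial derivative as a sum of products whose factors are covered by
    induction or by assumption. *)
Lemma Ck_comp (R : realType) m n k (U : set 'rV[R]_n) (W : set 'rV[R]_m)
    (phi : 'rV[R]_n -> 'rV[R]_m) f : open U ->
  (forall u, U u -> W (phi u)) -> (forall j, Ck k U (fun u => phi u 0 j)) ->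
  Ck k W f -> Ck k U (f \o phi).
Proof.
move=> oU UW; elim: k f => // k IHk f Cphi [df Cf].
have dphi u j : U u -> differentiable (fun u => phi u 0 j) u by case: (Cphi j) => d _ /d.
split=> [u Uu|i].
  by apply: differentiable_comp; [apply: differentiable_rV => j; exact: dphi|exact/df/UW].
apply: (eq_Ck oU (f := fun u =>
    \sum_j (partial j f \o phi) u * partial i (fun v => phi v 0 j) u)) => [u Uu|].
  by rewrite partial_comp//; [move=> j; exact: dphi|exact/df/UW].
apply: Ck_sum => // j; apply: CkM => //; last exact: (Cphi j).2.
by apply: IHk; [move=> j'; exact: CkW|exact: Cf].
Qed.

(** * The function exp(-1/t), flat at 0 *)

Section FlatExponential.
Variable R : realType.
Implicit Types (p : {poly R}) (t : R).

(* For a polynomial p, the function p(1/t) exp(-1/t) extended by 0 to t <= 0;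
   this family is closed under differentiation. *)
Definition flat_exp p t : R := if 0 < t then p.[t^-1] * expR (- t^-1) else 0.

(** With s = 1/t, the derivative d/dt is -s^2 d/ds, which sends p(s) exp(-s) to s^2 (p - p')(s)
    exp(-s). *)
Definition flat_exp_der p : {poly R} := 'X^2 * (p - p^`()).

(** With k = m + 1, exp(-1/t) is the k-th power of exp(-1/(kt)), and the latter is at most kt
    because exp y >= 1 + y. *)
Lemma expRN_inv_le (m : nat) t : 0 < t -> expR (- t^-1) <= (m.+1%:R * t) ^+ m.+1.
Proof.
move=> t0; set k := m.+1; have k0 : 0 < k%:R :> R by rewrite ltr0n.
have -> : - t^-1 = k%:R * (- (k%:R * t)^-1).
  by field; rewrite !gt_eqF.
rewrite expRM_natl lerXn2r ?nnegrE ?expR_ge0//; first by rewrite mulr_ge0 ?ltW.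
rewrite expRN invf_ple ?posrE ?expR_gt0 ?mulr_gt0//.
by apply: le_trans (expR_ge1Dx _); rewrite lerDr.
Qed.

(** On (0, 1] the power of [t] absorbs every monomial of p(1/t), as the degrees stay below
    [size p]. *)
Lemma horner_inv_le p : exists2 C, 0 <= C & forall t, 0 < t <= 1 ->
  `|p.[t^-1]| * t ^+ size p <= C.
Proof.
exists (\sum_(i < size p) `|p`_i|); first by apply: sumr_ge0 => i _; exact: normr_ge0.
move=> t /andP[t0 t1]; rewrite -[in X in _ * X](gtr0_norm t0) -normrX -normrM.
rewrite horner_coef big_distrl/= (le_trans (ler_norm_sum _ _ _))//.
apply: ler_sum => i _; rewrite -mulrA normrM ler_piMr//.
rewrite -[X in t ^+ X](subnKC (ltnW (ltn_ord i))) exprD mulrA -exprMn.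
rewrite mulVf ?gt_eqF// expr1n mul1r.
by rewrite normrX gtr0_norm// exprn_ile1// ltW.
Qed.

(** The quadratic bound is what gives derivative 0 at the origin. *)
Lemma flat_exp_le p : exists2 C, 0 < C & forall t, t <= 1 -> `|flat_exp p t| <= C * t ^+ 2.
Proof.
have [C C0 hC] := horner_inv_le p; set m := size p.
have [N [N_ge0 hN]] : exists N : R, 0 <= N /\
    forall t, 0 < t -> expR (- t^-1) <= N * (t ^+ m * t ^+ 2).
  (* Of the m + 2 powers of [t], m compensate the pole of p(1/t) and two remain for the bound. *)
  exists (m.+2%:R ^+ m.+2); split=> [|t t0]; first exact: exprn_ge0.
  apply: le_trans (expRN_inv_le m.+1 t0) _.
  by rewrite exprMn -exprD addn2.
exists (C * N + 1); first by rewrite ltr_pwDr// mulr_ge0.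
move=> t t1; rewrite /flat_exp; case: ifPn => [t0|_]; last first.
  by rewrite normr0 mulr_ge0 ?sqr_ge0// addr_ge0// mulr_ge0.
rewrite normrM (ger0_norm (expR_ge0 _)).
apply: (le_trans (ler_wpM2l (normr_ge0 _) (hN _ t0))).
have pC : `|p.[t^-1]| * t ^+ m <= C by rewrite hC// t0.
move: (t ^+ 2) (t ^+ m) (sqr_ge0 t) pC => s r s0 pC.
rewrite !mulrA; apply: (ler_wpM2r s0); rewrite mulrAC ler_wpDr//.
exact: ler_wpM2r.
Qed.

Lemma is_derive_flat_exp p t : is_derive t (1 : R) (flat_exp p) (flat_exp (flat_exp_der p) t).
Proof.
have [t0|t0|->] := ltgtP t 0.
- rewrite {2}/flat_exp ltNge (ltW t0)/=.
  apply: (@near_eq_is_derive _ _ _ (cst 0)).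
  near=> s; rewrite /flat_exp ltNge ltW//.
  by near: s; exact: lt_nbhsl.
- rewrite {2}/flat_exp t0.
  have dV : is_derive t (1 : R) (fun s => s^-1) (- t ^- 2 *: (1 : R)).
    by apply: is_deriveV; rewrite gt_eqF.
  have dp : is_derive t (1 : R) (horner p \o (fun s => s^-1)) _ :=
    is_derive1_comp (is_derive_poly p _) dV.
  have de : is_derive t (1 : R) (expR \o (fun s => - s^-1)) _ :=
    is_derive1_comp (is_derive_expR _) (is_deriveN dV).
  have dpe := is_deriveM dp de.
  apply: (near_eq_is_derive (f := (horner p \o (fun s => s^-1)) * (expR \o (fun s => - s^-1)))).
    near=> s; rewrite /flat_exp ifT//.
    by near: s; exact: lt_nbhsr.
  apply: is_derive_eq => /=.
  rewrite /flat_exp_der !hornerE /GRing.scale /=.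
  by field; rewrite gt_eqF.
- rewrite {2}/flat_exp ltxx.
  (* The difference quotient at 0 is at most C|h| in absolute value. *)
  have [C C0 hC] := flat_exp_le p.
  have lim0 : (fun h : R => h^-1 *: ((flat_exp p \o shift 0) (h *: 1) - flat_exp p 0))
      @ 0^' --> (0 : R).
    apply/cvgrPdist_le => e e0; near=> h.
    have h1 : `|h| <= Num.min 1 (e / C).
      by near: h; apply: dnbhs0_le; rewrite lt_min ltr01 divr_gt0.
    have h0 : h != 0 by near: h; exact: nbhs_dnbhs_neq.
    rewrite /= {2}/flat_exp ltxx addr0 [h *: 1]mulr1 subr0 sub0r normrN.
    rewrite normrM normfV mulrC ler_pdivrMr ?normr_gt0//.
    move: h1; rewrite le_min => /andP[h1]; rewrite ler_pdivlMr// => hC'.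
    apply: le_trans (hC h (le_trans (ler_norm _) h1)) _.
    rewrite -(real_normK (num_real h)) expr2 mulrA ler_wpM2r//.
    by rewrite mulrC.
  split; first by apply/cvg_ex; exists 0.
  exact: cvg_lim lim0.
Unshelve. all: by end_near. Qed.

End FlatExponential.

(** The induction on k treats all polynomials at once, since each derivative changes [p]. *)
Lemma Ck_flat_exp (R : realType) n k (U : set 'rV[R]_n) (f : 'rV[R]_n -> R) p :
  open U -> Ck k U f -> Ck k U (flat_exp p \o f).
Proof.
move=> oU; elim: k p => // k IHk p Cf'; have [df Cf] := Cf'.
have de q t : is_derive t (1 : R) (flat_exp q) (flat_exp (flat_exp_der q) t).
  exact: is_derive_flat_exp.
have deE q t : 'D_(1 : R) (flat_exp q) t = flat_exp (flat_exp_der q) t by case: (de q t).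
have dq (q : {poly R}) t : differentiable (flat_exp q) t.
  by apply/derivable1_diffP; case: (de q t).
split=> [u Uu|i]; first by apply: differentiable_comp; [exact: df|exact: dq].
apply: (eq_Ck oU (f := fun u =>
    (flat_exp (flat_exp_der p) \o f) u * partial i f u)) => [u Uu|].
  rewrite [RHS]partialE; last by apply: differentiable_comp; [exact: df|exact: dq].
  rewrite (diff_comp (df _ Uu) (dq _ _))/= -(deriveE _ (df _ Uu)).
  rewrite -[X in 'd _ _ X]mulr1 [X in 'd _ _ X]/(_ *: (1 : R)) linearZ/=.
  rewrite -(deriveE _ (dq _ _)) deE.
  by rewrite mulrC.
by apply: CkM => //; [apply: IHk; exact: CkW|exact: Cf].
Qed.

(** * Symmetries of the Riemann tensor *)

Section DifferentiableInverse.
Variables (R : realType) (V : normedModType R).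

Lemma differentiable_bigsum (I : Type) (s : seq I) (P : pred I) (F : I -> V -> R) x :
  (forall i, differentiable (F i) x) ->
  differentiable (fun v => \sum_(i <- s | P i) F i v) x.
Proof.
move=> dF; elim: s => [|i s IHs].
  by under eq_fun do rewrite big_nil; exact: differentiable_cst.
case Pi : (P i).
  by under eq_fun do rewrite big_cons Pi; exact: differentiableD.
by under eq_fun do rewrite big_cons Pi.
Qed.

Lemma differentiable_bigprod (I : Type) (s : seq I) (P : pred I) (F : I -> V -> R) x :
  (forall i, differentiable (F i) x) ->
  differentiable (fun v => \prod_(i <- s | P i) F i v) x.
Proof.
move=> dF; elim: s => [|i s IHs].
  by under eq_fun do rewrite big_nil; exact: differentiable_cst.
case Pi : (P i).
  by under eq_fun do rewrite big_cons Pi; exact: differentiableM.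
by under eq_fun do rewrite big_cons Pi.
Qed.

Lemma differentiable_det n (A : V -> 'M[R]_n) x :
  (forall i j, differentiable (fun v => A v i j) x) ->
  differentiable (fun v => \det (A v)) x.
Proof.
move=> dA; apply: differentiable_bigsum => s; apply: differentiableM.
  exact: differentiable_cst.
by apply: differentiable_bigprod => i.
Qed.

(** By Cramer's rule the entry is, near [x], a cofactor divided by the determinant. Invertibility is
    asked on a neighbourhood because [invmx] returns its argument at a singular matrix. *)
Lemma differentiable_invmx n (A : V -> 'M[R]_n) x i j :
  (\near x, A x \in unitmx) ->
  (forall i j, differentiable (fun v => A v i j) x) ->
  differentiable (fun v => invmx (A v) i j) x.
Proof.
move=> uA dA.
apply: (@near_eq_differentiable _ _ _ (fun v => (\det (A v))^-1 * cofactor (A v) j i)).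
  move: uA; apply: filterS => v Av; rewrite /invmx Av !mxE.
  by [].
apply: differentiableM; last first.
  apply: differentiableM; first exact: differentiable_cst.
  apply: differentiable_det => k l.
  by under eq_fun do rewrite !mxE.
apply: differentiableV; first exact: differentiable_det.
by have := nbhs_singleton uA; rewrite unitmxE unitfE.
Qed.

End DifferentiableInverse.

Section RiemannSymmetries.
Variables (R : realType) (n : nat) (G : 'rV[R]_n -> 'M[R]_n) (U : set 'rV[R]_n).
Hypothesis oU : open U.
Hypothesis smooth_G : forall i j, smooth_on U (fun u => G u i j).
Hypothesis sym_G : forall u, U u -> (G u)^T = G u.
Hypothesis unit_G : forall u, U u -> G u \in unitmx.

Lemma riemann13_anti i j k l u : riemann13 G i j k l u = - riemann13 G j i k l u.
Proof.
rewrite /riemann13 opprD opprB; congr (_ + _).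
by rewrite -sumrN; apply: eq_bigr => m _; rewrite opprB.
Qed.

Lemma riemann04_anti12 i j k l u : riemann04 G i j k l u = - riemann04 G j i k l u.
Proof.
rewrite /riemann04 -sumrN; apply: eq_bigr => m _.
by rewrite riemann13_anti mulNr.
Qed.

Lemma nearU u (P : 'rV[R]_n -> Prop) : U u -> (forall v, U v -> P v) -> \near u, P u.
Proof. by move=> Uu UP; apply: filterS (open_nbhs_nbhs (conj oU Uu)). Qed.

Lemma G_sym u i j : U u -> G u i j = G u j i.
Proof. by move=> Uu; rewrite -[in LHS]sym_G// mxE. Qed.

Lemma partial_G_sym u i j k : U u ->
  partial k (fun v => G v i j) u = partial k (fun v => G v j i) u.
Proof. by move=> Uu; apply: partial_near; apply: nearU => // v; exact: G_sym. Qed.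

Lemma christoffel_sym u l i j : U u -> christoffel G l i j u = christoffel G l j i u.
Proof.
move=> Uu; rewrite /christoffel; congr (_ * _); apply: eq_bigr => m _.
by rewrite (partial_G_sym i j m Uu) [X in _ * (X - _)]addrC.
Qed.

Lemma partial_christoffel_sym u k l i j : U u ->
  partial k (christoffel G l i j) u = partial k (christoffel G l j i) u.
Proof. by move=> Uu; apply: partial_near; apply: nearU => // v; exact: christoffel_sym. Qed.

(** The connection has no torsion: the Christoffel symbols are symmetric in their lower indices, so
    derivative terms and quadratic terms both cancel in pairs around the cycle. *)
Lemma riemann04_bianchi i j k l u : U u ->
  riemann04 G i j k l u + riemann04 G j k i l u + riemann04 G k i j l u = 0.
Proof.
move=> Uu; rewrite /riemann04 -!big_split big1//= => m _.
rewrite -!mulrDl; apply/eqP; rewrite mulf_eq0; apply/orP; left; apply/eqP.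
rewrite /riemann13 (partial_christoffel_sym k m j i Uu) (partial_christoffel_sym j m k i Uu)
  (partial_christoffel_sym i m k j Uu).
have cyclic (a b c s1 s2 s3 : R) : s1 = - (s2 + s3) ->
    a - b + s1 + (b - c + s2) + (c - a + s3) = 0 by move=> ->; ring.
apply: cyclic; rewrite -big_split -sumrN /=; apply: eq_bigr => p _.
rewrite (christoffel_sym p k j Uu) (christoffel_sym p i k Uu) (christoffel_sym p j i Uu).
have cyclicM (x y z a b c : R) : x * a - y * b = - (y * b - z * c + (z * c - x * a)) by ring.
exact: cyclicM.
Qed.

Lemma diff_G u i j : U u -> differentiable (fun v => G v i j) u.
Proof. by move=> Uu; exact: (smooth_G i j [::]). Qed.

Lemma diff_partial_G u k i j : U u -> differentiable (partial k (fun v => G v i j)) u.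
Proof. by move=> Uu; exact: (smooth_G i j [:: k]). Qed.

Lemma partial_commute_G u k l i j : U u ->
  partial k (partial l (fun v => G v i j)) u = partial l (partial k (fun v => G v i j)) u.
Proof.
move=> Uu; apply: derive_commute; try exact: diff_partial_G.
by apply: nearU => // v Uv; exact: diff_G.
Qed.

Lemma diff_christoffel u l i j : U u -> differentiable (christoffel G l i j) u.
Proof.
move=> Uu; apply: differentiableM; first exact: differentiable_cst.
apply: differentiable_bigsum => m; apply: differentiableM.
  apply: differentiable_invmx; first by apply: nearU => // v; exact: unit_G.
  by move=> *; exact: diff_G.
apply: differentiableB; last exact: diff_partial_G.
by apply: differentiableD; exact: diff_partial_G.
Qed.

(* Christoffel symbols of the first kind: the index l is lowered *)
Let Gam l j k u := 2^-1 * (partial j (fun v => G v k l) u + partial k (fun v => G v j l) u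
  - partial l (fun v => G v j k) u).

Lemma lower_christoffel u l j k : U u -> \sum_m christoffel G m j k u * G u m l = Gam l j k u.
Proof.
move=> Uu; rewrite /christoffel /Gam.
under eq_bigr => m _ do rewrite -mulrA big_distrl /=.
rewrite -big_distrr /=; congr (_ * _); rewrite exchange_big /=.
rewrite (bigD1 l)//= [X in _ + X]big1 => [|p pl].
  under eq_bigr => m _ do rewrite mulrAC (mulrC (invmx _ _ _)) (G_sym m l Uu).
  rewrite -big_distrl /= addr0.
  have /matrixP/(_ l l) := mulmxV (unit_G Uu); rewrite !mxE eqxx => ->.
  by rewrite mul1r.
under eq_bigr => m _ do rewrite mulrAC (mulrC (invmx _ _ _)) (G_sym m l Uu).
rewrite -big_distrl /=.
have /matrixP/(_ l p) := mulmxV (unit_G Uu); rewrite !mxE eq_sym (negbTE pl) => ->.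
by rewrite mul0r.
Qed.

(** Compatibility of the Levi-Civita connection with the metric, in coordinates. *)
Lemma partial_G u i k l : U u -> partial i (fun v => G v k l) u = Gam l i k u + Gam k i l u.
Proof.
have alg (x b c : R) : x = 2^-1 * (x + b - c) + 2^-1 * (x + c - b) by lra.
by move=> Uu; rewrite /Gam (partial_G_sym l k i Uu); exact: alg.
Qed.

(** This is g(nabla_{e_i} e_j, nabla_{e_k} e_l). *)
Let quad (u : 'rV[R]_n) i j k l :=
  \sum_m \sum_p christoffel G m i j u * christoffel G p k l u * G u m p.

Lemma quad_sym u i j k l : U u -> quad u i j k l = quad u k l i j.
Proof.
move=> Uu; rewrite /quad exchange_big; apply: eq_bigr => m _; apply: eq_bigr => p _ /=.
by rewrite (G_sym m p Uu) (mulrC (christoffel G p _ _ _)).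
Qed.

Lemma quadE u i j k l : U u -> quad u i j k l = \sum_m christoffel G m i j u * Gam m k l u.
Proof.
move=> Uu; apply: eq_bigr => m _; rewrite -lower_christoffel// big_distrr /=.
by apply: eq_bigr => p _; rewrite (G_sym m p Uu) mulrA.
Qed.

Lemma lower_partial_christoffel u i j k l : U u ->
  \sum_m partial i (christoffel G m j k) u * G u m l =
  partial i (Gam l j k) u - \sum_m christoffel G m j k u * partial i (fun v => G v m l) u.
Proof.
move=> Uu.
have -> : partial i (Gam l j k) u =
    partial i (fun v => \sum_m (christoffel G m j k \* (fun v => G v m l)) v) u.
  by apply: partial_near; apply: nearU => // v Uv; rewrite lower_christoffel.
rewrite partial_sum => [|m].
  rewrite -sumrB; apply: eq_bigr => m _.
  by rewrite partialM ?addrK//; [exact: diff_christoffel|exact: diff_G].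
by apply: differentiableM; [exact: diff_christoffel|exact: diff_G].
Qed.

(** Moving the metric inside the derivatives leaves products of Christoffel symbols with derivatives
    of [G]. [partial_G] splits each in two: one half cancels the quadratic terms of [riemann13], the
    other is a [quad]. *)
Lemma riemann04E u i j k l : U u -> riemann04 G i j k l u =
  partial i (Gam l j k) u - partial j (Gam l i k) u - quad u j k i l + quad u i k j l.
Proof.
move=> Uu.
have sum3 (a b c g : 'I_n -> R) : \sum_m (a m - b m + c m) * g m =
    \sum_m a m * g m - \sum_m b m * g m + \sum_m c m * g m.
  by rewrite -sumrB -big_split; apply: eq_bigr => m _ /=; ring.
transitivity (\sum_m partial i (christoffel G m j k) u * G u m l
    - \sum_m partial j (christoffel G m i k) u * G u m l
    + \sum_m (\sum_p (christoffel G p j k u * christoffel G m i p u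
      - christoffel G p i k u * christoffel G m j p u)) * G u m l).
  exact: sum3.
rewrite [X in X - _ + _](lower_partial_christoffel i j k l Uu).
rewrite [X in _ - X + _](lower_partial_christoffel j i k l Uu).
have split_quad a b c : \sum_m christoffel G m b c u * partial a (fun v => G v m l) u =
    \sum_m christoffel G m b c u * Gam l a m u + quad u b c a l.
  rewrite quadE// -big_split; apply: eq_bigr => m _ /=.
  by rewrite (partial_G a m l Uu) mulrDr.
rewrite [X in _ - X - _ + _](split_quad i j k) [X in _ - (_ - X) + _](split_quad j i k).
rewrite [X in _ + X](_ : _ = \sum_m christoffel G m j k u * Gam l i m u
    - \sum_m christoffel G m i k u * Gam l j m u); last first.
  under eq_bigr => m _ do rewrite big_distrl /=.
  rewrite exchange_big -sumrB; apply: eq_bigr => p _ /=.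
  rewrite -!lower_christoffel// !big_distrr -sumrB; apply: eq_bigr => m _ /=.
  by rewrite mulrBl !mulrA.
have alg (a b s t q r : R) : a - (s + q) - (b - (t + r)) + (s - t) = a - b - q + r by ring.
exact: alg.
Qed.

(** Symmetrising [riemann04E] in [k] and [l] cancels the [quad] terms and, by [partial_G], leaves a
    commutator of second derivatives of the metric. *)
Lemma riemann04_anti34 i j k l u : U u -> riemann04 G i j k l u = - riemann04 G i j l k u.
Proof.
move=> Uu; rewrite !riemann04E// (quad_sym i l j k Uu) (quad_sym j l i k Uu).
have dGam a b c : differentiable (Gam a b c) u.
  apply: differentiableM; first exact: differentiable_cst.
  apply: differentiableB; last exact: diff_partial_G.
  by apply: differentiableD; exact: diff_partial_G.
have e a b : partial a (Gam l b k) u + partial a (Gam k b l) u =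
    partial a (partial b (fun v => G v k l)) u.
  rewrite -partialD//; apply: partial_near; apply: nearU => // v Uv.
  by rewrite partial_G.
have := e i j; rewrite partial_commute_G// -e.
have alg (a b c d q r : R) : a + b = c + d -> a - c - q + r = - (b - d - r + q).
  by move=> /(canRL (addrK _)) ->; ring.
by move=> h; exact: alg h.
Qed.

End RiemannSymmetries.

(** * Vector fields through a given tangent vector *)

(** Tangent vectors are rows, which puts the Jacobian of the inner map on the left. *)
Lemma jacobian_comp (R : realType) m n l (f : 'rV[R]_m -> 'rV[R]_n) (g : 'rV[R]_n -> 'rV[R]_l) u :
  differentiable f u -> differentiable g (f u) ->
  'J (g \o f) u = 'J f u *m 'J g (f u).
Proof.
move=> df dg; apply/row_matrixP => i; rewrite !rowE mulmxA /jacobian !mul_rV_lin1.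
by rewrite diff_comp.
Qed.

Lemma near_eq_jacobian (R : realType) m n (f g : 'rV[R]_m -> 'rV[R]_n) u :
  differentiable f u -> (\near u, f u = g u) -> 'J f u = 'J g u.
Proof.
move=> df fg; have dg := near_eq_differentiable fg df.
apply/row_matrixP => i.
apply: etrans (rowE _ _) (etrans _ (esym (rowE _ _))).
apply: etrans (esym (deriveEjacobian _ df)) (etrans _ (deriveEjacobian _ dg)).
exact: near_eq_derive.
Qed.

Lemma smooth_on_local (R : realType) n (U : set 'rV[R]_n) f :
  (forall u, U u -> exists2 V, V u & smooth_on V f) -> smooth_on U f.
Proof. by move=> loc s u /loc[V Vu sV]; exact: sV. Qed.

(** * Smooth bump functions on R^n *)

Section Bump.
Variables (R : realType) (n : nat) (a : 'rV[R]_n) (r : R).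
Hypothesis r0 : 0 < r.

(** A sum of squares is polynomial, hence smooth, unlike the maximum norm of row vectors. *)
Let paraboloid (u : 'rV[R]_n) : R := r ^+ 2 - \sum_j (u 0 j - a 0 j) ^+ 2.

Definition bump : 'rV[R]_n -> R := flat_exp 1 \o paraboloid.

Lemma bump_Ck k : Ck k setT bump.
Proof.
apply: Ck_flat_exp; first exact: openT.
have Cd j : Ck k setT (fun u : 'rV[R]_n => u 0 j - a 0 j).
  by apply: (CkD openT (Ck_coord _ _ _) (Ck_cst k setT (- a 0 j))).
have Cs := Ck_sum openT (fun j => CkM openT (Cd j) (Cd j)).
have := CkD openT (Ck_cst k setT (r ^+ 2)) (CkM openT (Ck_cst k setT (-1)) Cs).
apply: eq_Ck; first exact: openT.
by move=> u _; rewrite /paraboloid /= mulN1r.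
Qed.

Lemma bump_center : bump a != 0.
Proof.
rewrite /bump /= /flat_exp /paraboloid big1 => [|j _]; last by rewrite subrr expr0n.
by rewrite subr0 exprn_gt0// hornerE mul1r gt_eqF// expR_gt0.
Qed.

(** The coordinate at which the maximum norm is attained already makes the sum of squares at least
    r^2. *)
Lemma bump_out u : r < `|a - u| -> bump u = 0.
Proof.
move=> ru; rewrite /bump /= /flat_exp ifF//; apply/negbTE; rewrite -leNgt subr_le0.
have [|[i j] e] := @mx_norm_neq0 _ _ _ (a - u).
  by rewrite gt_eqF// (lt_trans r0).
move: ru; rewrite [`|a - u|]e /= ord1 !mxE => ru.
rewrite (bigD1 j)//=; apply: ler_wpDr.
  by apply: sumr_ge0 => k _; exact: sqr_ge0.
rewrite -(real_normK (num_real (u 0 j - _))) distrC.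
by rewrite lerXn2r ?nnegrE ?normr_ge0// ltW.
Qed.

End Bump.

(** * Transition maps and their Jacobians *)

Section ChartChange.
Variables (R : realType) (n : nat) (M : manifold R n).
Implicit Types (c d e : chart R n M) (x y : M).

Lemma overlap_open c d : open (overlap c d).
Proof.
rewrite openE => u [cu du].
have nc : nbhs u (cod c) by exact: open_nbhs_nbhs (conj (@cod_open _ _ _ c) cu).
have nd : nbhs u (param c @^-1` dom d).
  exact: (param_continuous cu (open_nbhs_nbhs (conj (dom_open d) du))).
exact: filterI nc nd.
Qed.

Lemma overlap_coord c d x : dom c x -> dom d x -> overlap c d (coord c x).
Proof. by move=> cx dx; split; [exact: coord_cod|rewrite coordK]. Qed.

Lemma transition_overlap c d u : overlap c d u -> overlap d c (transition c d u).
Proof. by move=> [cu du]; apply: overlap_coord => //; exact: param_dom. Qed.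

Lemma transition_diff c d u j : atlas c -> atlas d -> overlap c d u ->
  differentiable (fun v => transition c d v 0 j) u.
Proof. by move=> ac ad; exact: (atlas_compatible ac ad j [::]). Qed.

Lemma transition_differentiable c d u : atlas c -> atlas d -> overlap c d u ->
  differentiable (transition c d) u.
Proof. by move=> ac ad cdu; apply: differentiable_rV => j; exact: transition_diff. Qed.

(** The transition maps compose near the point, so the chain rule applies. *)
Lemma change_comp c d e x : chart_at c x -> chart_at d x -> chart_at e x ->
  change c e x = change c d x *m change d e x.
Proof.
move=> [ac cx] [ad dx] [ae ex]; rewrite /change.
have cdx := overlap_coord cx dx; have dex := overlap_coord dx ex.
have tx : transition c d (coord c x) = coord d x by rewrite /transition /= coordK.
rewrite -[in 'J (transition d e) _]tx -jacobian_comp; last first.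
- by rewrite tx; exact: transition_differentiable.
- exact: transition_differentiable.
apply: near_eq_jacobian; first exact/transition_differentiable/overlap_coord.
apply: filterS (open_nbhs_nbhs (conj (@overlap_open c d) cdx)) => u [cu du].
by rewrite /transition /= coordK.
Qed.

Lemma change_id c x : chart_at c x -> change c c x = 1%:M.
Proof.
move=> [ac cx]; rewrite /change.
have ccx := overlap_coord cx cx.
rewrite (@near_eq_jacobian _ _ _ _ id) => [||]; last 2 first.
- exact: transition_differentiable.
- apply: filterS (open_nbhs_nbhs (conj (@cod_open _ _ _ c) ccx.1)) => u cu.
  by rewrite /transition /= paramK.
apply/row_matrixP => i; rewrite !rowE /jacobian mul_rV_lin1 mulmx1.
by rewrite diff_val.
Qed.

End ChartChange.

(** * Extension of a tangent vector by a bump function *)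

Section LocalVectorField.
Variables (R : realType) (n : nat) (M : manifold R n) (c : chart R n M) (x : M).
Hypothesis cx : chart_at c x.
Variables (r : R) (w : 'rV[R]_n).
Hypotheses (r0 : 0 < r) (ball_cod : forall u, `|coord c x - u| <= r -> cod c u).

Local Notation b := (bump (coord c x) r).
Local Notation B := [set u | `|coord c x - u| <= r].

(* Extension by 0 outside the domain of c of the vector field with components
   b w in the chart c. *)
Definition bump_field (d : chart R n M) (y : M) : 'rV[R]_n :=
  if `[< dom c y >] then b (coord c y) *: (w *m change c d y) else 0.

Lemma bump_field_change d e y : chart_at d y -> chart_at e y ->
  bump_field e y = bump_field d y *m change d e y.
Proof.
move=> dy ey; rewrite /bump_field; case: asboolP => [cy|_]; last by rewrite mul0mx.
have cy' : chart_at c y by split=> //; exact: cx.1.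
by rewrite (change_comp cy' dy ey) -scalemxAl mulmxA.
Qed.

(** The closed ball is compact, hence so is its image, and compact sets of a Hausdorff space are
    closed. The field therefore vanishes on an open set containing all points outside [dom c]. *)
Lemma bump_support_closed : closed (param c @` B).
Proof.
apply: compact_closed; first exact: manifold_hausdorff.
apply: continuous_compact.
  apply: continuous_in_subspaceT => u; rewrite inE => Bu.
  exact/param_continuous/ball_cod.
have -> : B = closed_ball (coord c x) r by rewrite closed_ballE.
apply: bounded_closed_compact; last exact: closed_ball_closed.
rewrite closed_ballE//; exists (`|coord c x| + r); split; first exact: num_real.
move=> t tr u /= Bu; apply: le_trans (ltW tr).
rewrite -[u](subKr (coord c x)) (le_trans (ler_normB _ _))// lerD2l.
exact: Bu.
Qed.

Lemma bump_field_smooth d : atlas d -> forall i : 'I_n,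
  smooth_on (cod d) (fun u => bump_field d (param d u) 0 i).
Proof.
move=> ad i; have [ac cx'] := cx.
(* On the overlap with [c] the components are products of smooth functions; a point outside [dom c]
   has a neighbourhood that avoids the support. *)
apply: smooth_on_local => u du; have [cu|ncu] := pselect (dom c (param d u)).
  exists (overlap d c); first by split.
  apply/smooth_onP => k; have oV := @overlap_open _ _ _ d c.
  have Ctau j : Ck k (overlap d c) (fun v => transition d c v 0 j).
    by move: k; apply/smooth_onP; exact: atlas_compatible.
  have CJ j : Ck k (overlap c d) (partial j (fun v => transition c d v 0 i)).
    (* One more order is requested because the Jacobian costs a derivative. *)
    have /smooth_onP/(_ k.+1)[_] := atlas_compatible ac ad i.
    by apply.
  have Cb : Ck k (overlap d c) (b \o transition d c).
    by apply: (Ck_comp oV (W := setT)) => //; exact: bump_Ck.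
  have Cs := Ck_sum oV (fun j => CkM oV (Ck_cst k _ (w 0 j))
    (Ck_comp oV (@transition_overlap _ _ _ d c) Ctau (CJ j))).
  apply: eq_Ck (CkM oV Cb Cs) => // v cdv.
  rewrite /bump_field; case: asboolP => [_|/(_ cdv.2)//].
  rewrite !mxE /=; congr (_ * _); apply: eq_bigr => j _; congr (_ * _).
  rewrite /change jacobianE// => j'; apply: transition_diff => //.
  exact: transition_overlap cdv.
exists (cod d `&` param d @^-1` ~` (param c @` B)).
  split=> //= -[v Bv e]; apply: ncu; rewrite -e; apply: param_dom; exact: ball_cod.
have oV : open (cod d `&` param d @^-1` ~` (param c @` B)).
  rewrite openE => v [dv Kv].
  have nd : nbhs v (cod d) by exact: open_nbhs_nbhs (conj (@cod_open _ _ _ d) dv).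
  have oK : open (~` (param c @` B)) by exact/closed_openC/bump_support_closed.
  have nK : nbhs v (param d @^-1` ~` (param c @` B)).
    exact: (param_continuous dv (open_nbhs_nbhs (conj oK Kv))).
  exact: filterI nd nK.
apply/smooth_onP => k; apply: eq_Ck (Ck_cst k _ 0) => // v [dv Kv].
rewrite /bump_field; case: asboolP => [cv|_]; last by rewrite mxE.
rewrite bump_out// ?scale0r ?mxE// ltNge; apply/negP => Bv.
by apply: Kv; exists (coord c (param d v)) => //; rewrite coordK.
Qed.

Definition bump_vector_field : vector_field M :=
  VectorField bump_field_change bump_field_smooth.

End LocalVectorField.

Lemma vector_field_through (R : realType) n (M : manifold R n) (c : chart R n M) (x : M)
    (w : 'rV[R]_n) : chart_at c x -> exists X : vector_field M, X c x = w.
Proof.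
move=> cx; have [ac cx'] := cx.
have /nbhs_ballP[r /= r0 rc] := open_nbhs_nbhs (conj (@cod_open _ _ _ c) (coord_cod cx')).
(* Halving the radius keeps the closed ball inside the open ball contained in [cod c]. *)
have r20 : 0 < r / 2 by rewrite divr_gt0.
have rc' u : `|coord c x - u| <= r / 2 -> cod c u.
  move=> ur; apply: rc; rewrite -ball_normE /= (le_lt_trans ur)//.
  by rewrite ltr_pdivrMr// ltr_pMr// ltr1n.
(* Division by the value of the bump at its centre makes the field take the value [w] there. *)
exists (bump_vector_field cx ((bump (coord c x) (r / 2) (coord c x))^-1 *: w) r20 rc').
rewrite /= /bump_field; case: asboolP => // _.
rewrite (change_id cx) mulmx1 scalerA mulfV ?scale1r//.
exact: bump_center.
Qed.

(** * Curvature at a point of the manifold *)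

Section QuadrilinearForm.
Variables (F : comRingType) (n : nat).
Implicit Types (t : 'I_n -> 'I_n -> 'I_n -> 'I_n -> F) (X Y Z T : 'rV[F]_n).

(** [Riem] is convertible to such a form, so its symmetries reduce to those of [riemann04] under
    permutations of the indices. *)
Definition qform t X Y Z T : F := \sum_(i < n) \sum_(j < n) \sum_(k < n) \sum_(l < n)
  t i j k l * X 0 i * Y 0 j * Z 0 k * T 0 l.

Lemma eq_qform t t' X Y Z T : (forall i j k l, t i j k l = t' i j k l) ->
  qform t X Y Z T = qform t' X Y Z T.
Proof. by move=> e; do 4 (apply: eq_bigr => ? _); rewrite e. Qed.

Lemma qformN t X Y Z T : qform (fun i j k l => - t i j k l) X Y Z T = - qform t X Y Z T.
Proof.
rewrite /qform -sumrN; do 3 (apply: eq_bigr => ? _; rewrite -sumrN).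
by apply: eq_bigr => ? _; rewrite !mulNr.
Qed.

Lemma qformD t t' X Y Z T :
  qform (fun i j k l => t i j k l + t' i j k l) X Y Z T = qform t X Y Z T + qform t' X Y Z T.
Proof.
rewrite /qform -big_split; do 3 (apply: eq_bigr => ? _; rewrite -big_split).
by apply: eq_bigr => ? _; rewrite /= !mulrDl.
Qed.

Lemma qform_swap12 t X Y Z T : qform t X Y Z T = qform (fun i j => t j i) Y X Z T.
Proof.
rewrite /qform exchange_big; do 4 (apply: eq_bigr => ? _).
by congr (_ * _ * _); rewrite mulrAC.
Qed.

Lemma qform_swap23 t X Y Z T : qform t X Y Z T = qform (fun i j k => t i k j) X Z Y T.
Proof.
apply: eq_bigr => i _; rewrite exchange_big; do 3 (apply: eq_bigr => ? _).
by congr (_ * _); rewrite mulrAC.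
Qed.

Lemma qform_swap34 t X Y Z T : qform t X Y Z T = qform (fun i j k l => t i j l k) X Y T Z.
Proof.
do 2 (apply: eq_bigr => ? _); rewrite exchange_big; do 2 (apply: eq_bigr => ? _).
by rewrite mulrAC.
Qed.

Lemma qform_linl t k X X' Y Z T :
  qform t (k *: X + X') Y Z T = k * qform t X Y Z T + qform t X' Y Z T.
Proof.
rewrite /qform mulr_sumr -big_split; apply: eq_bigr => i _ /=.
rewrite mulr_sumr -big_split; apply: eq_bigr => j _ /=.
rewrite mulr_sumr -big_split; apply: eq_bigr => k' _ /=.
rewrite mulr_sumr -big_split; apply: eq_bigr => l _ /=.
by rewrite !mxE; ring.
Qed.

End QuadrilinearForm.

Section CurvatureAtPoint.
Variables (R : realType) (n : nat) (M : manifold R n) (g : metric M).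
Variables (c : chart R n M) (x : M).
Hypothesis cx : chart_at c x.
Implicit Types X Y Z T : 'rV[R]_n.

Let G u := g c (param c u).
Let oU := @cod_open _ _ _ c.

Let smooth_G i j : smooth_on (cod c) (fun u => G u i j).
Proof. exact: gram_smooth cx.1 i j. Qed.

Let chart_param u : cod c u -> chart_at c (param c u).
Proof. by move=> cu; split; [exact: cx.1|exact: param_dom]. Qed.

Let sym_G u : cod c u -> (G u)^T = G u.
Proof. by move=> cu; exact/gram_sym/chart_param. Qed.

Let unit_G u : cod c u -> G u \in unitmx.
Proof. by move=> cu; exact/gram_nondegenerate/chart_param. Qed.

Let xU : cod c (coord c x). Proof. exact: coord_cod cx.2. Qed.

Lemma Riem_lin Y Z T : linform (fun X => Riem g c x X Y Z T).
Proof. by move=> k X X'; exact: qform_linl. Qed.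

Lemma Riem_anti12 X Y Z T : Riem g c x X Y Z T = - Riem g c x Y X Z T.
Proof.
rewrite -[RHS]qformN; apply: etrans (qform_swap12 _ _ _ _ _) _.
by apply: eq_qform => i j k l; exact: riemann04_anti12.
Qed.

Lemma Riem_anti34 X Y Z T : Riem g c x X Y Z T = - Riem g c x X Y T Z.
Proof.
rewrite -[RHS]qformN; apply: etrans (qform_swap34 _ _ _ _ _) _.
by apply: eq_qform => i j k l; exact: (riemann04_anti34 oU smooth_G sym_G unit_G).
Qed.

Lemma Riem_bianchi X Y Z T :
  Riem g c x X Y Z T + Riem g c x Y Z X T + Riem g c x Z X Y T = 0.
Proof.
pose r := fun i j k l => riemann04 G i j k l (coord c x).
have e1 : qform r Y Z X T = qform (fun i j k => r j k i) X Y Z T.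
  by rewrite qform_swap23 qform_swap12.
have e2 : qform r Z X Y T = qform (fun i j k => r k i j) X Y Z T.
  by rewrite qform_swap12 qform_swap23.
rewrite -[Riem g c x X Y Z T]/(qform r X Y Z T) -[Riem g c x Y Z X T]/(qform r Y Z X T).
rewrite -[Riem g c x Z X Y T]/(qform r Z X Y T) e1 e2 -!qformD.
rewrite /qform big1 // => i _; do 3 (rewrite big1 // => ? _).
by rewrite [X in X * _ * _ * _ * _](riemann04_bianchi oU sym_G) ?mul0r.
Qed.

End CurvatureAtPoint.

(** Each tangent vector is the value of a global field by [vector_field_through], which makes the
    identity pointwise. *)
Lemma venzi_forms_at (R : realType) n (M : manifold R n) (D : tensor4 M) (Pi : one_form M)
    c x X1 X2 X3 X4 X5 : venzi_forms D Pi -> chart_at c x ->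
  pairing Pi c x X1 * D c x X2 X3 X4 X5 + pairing Pi c x X2 * D c x X3 X1 X4 X5
  + pairing Pi c x X3 * D c x X1 X2 X4 X5 = 0.
Proof.
move=> hD cx.
have [Y1 <-] := vector_field_through X1 cx; have [Y2 <-] := vector_field_through X2 cx.
have [Y3 <-] := vector_field_through X3 cx; have [Y4 <-] := vector_field_through X4 cx.
have [Y5 <-] := vector_field_through X5 cx.
exact: hD.
Qed.

(** A form that is not null is known to have nonzero square in some chart only; this carries the
    fact to any other chart. *)
Lemma inner_sharp_chart (R : realType) n (M : manifold R n) (g : metric M) (Pi : one_form M)
    c d x : chart_at c x -> chart_at d x ->
  inner g c x (sharp g Pi c x) (sharp g Pi c x) =
  inner g d x (sharp g Pi d x) (sharp g Pi d x).
Proof.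
move=> cx dx; rewrite /inner.
set s := sharp g Pi c x; set J := change c d x.
have gc : g c x = J *m g d x *m J^T := gram_change g cx dx.
have J_unit : J^T \in unitmx.
  have := gram_nondegenerate g cx; rewrite gc !unitmxE det_mulmx unitrM.
  by case/andP.
(* The dual vector transforms by the Jacobian: cancelling the invertible [g d x] and [J^T] reduces
   this to the transformation law of [Pi]. *)
have -> : sharp g Pi d x = s *m J; last by rewrite gc (trmx_mul s J) !mulmxA.
have sg : s *m g c x = Pi c x by rewrite mulmxKV// gram_nondegenerate.
apply: (can_inj (mulmxK (gram_nondegenerate g dx))).
apply: (can_inj (mulmxK J_unit)).
rewrite mulmxKV ?gram_nondegenerate// -(form_change Pi cx dx) -sg gc.
by rewrite !mulmxA.
Qed.

Theorem theorem4p3 (R : realType) (n : nat) (hn : (3 <= n)%N)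
    (M : manifold R n) (hM : connected [set: M]) (g : metric M)
    (Pi : one_form M)
    (hP : venzi_space (Projective g))
    (hPi : associated_form (Projective g) Pi) :
  (forall x : M, nonnull_at g Pi x -> vanishes_at (Concircular g) x)
  /\ ((exists x : M, null_at g Pi x) ->
      venzi_space (Concircular g) /\ associated_form (Concircular g) Pi).
Proof.
have [venziPi Pi_neq0] := hPi.
have Pi_conc : venzi_forms (Concircular g) Pi.
  move=> X1 X2 X3 X4 X5 c x cx.
  (* Nonvanishing of [Pi] somewhere does not give it at [x]; at a zero of [Pi] the identity is
     trivial. *)
  have [Pi0|Pi0] := eqVneq (Pi c x) 0.
    by rewrite /pairing Pi0 !mul0mx !mxE !mul0r !addr0.
  exact: (conc_curv_venzi (gram_sym g cx) (gram_nondegenerate g cx) hn (Riem_lin g c x)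
    (Riem_anti12 g c x) (Riem_anti34 g cx) (Riem_bianchi g cx) Pi0
    (fun Y1 Y2 Y3 Y4 Y5 => venzi_forms_at Y1 Y2 Y3 Y4 Y5 venziPi cx)).
split; last by split=> //; exists Pi.
move=> x nonnull c cx X1 X2 X3 X4.
have vv : inner g c x (sharp g Pi c x) (sharp g Pi c x) != 0.
  apply/eqP => vv; apply: nonnull => d dx.
  by rewrite (inner_sharp_chart g Pi dx cx).
have Pi0 : Pi c x != 0.
  by apply: contraNneq vv => Pi0; rewrite /inner /sharp Pi0 !mul0mx mxE.
exact: (conc_curv_nonnull (gram_sym g cx) (gram_nondegenerate g cx) hn (Riem_lin g c x)
    (Riem_anti12 g c x) (Riem_anti34 g cx) (Riem_bianchi g cx) Pi0
    (fun Y1 Y2 Y3 Y4 Y5 => venzi_forms_at Y1 Y2 Y3 Y4 Y5 venziPi cx) _ _ _ _ vv).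
Qed.
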